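(* If $\|\alpha\|_\infty<(1+\|Id-L\|)^{-1}$, then $\mathcal{P}^{\alpha}(I\times J)$ is dense in $\mathcal{C}(I\times J,\mathbb{R})$ (with the uniform norm).
   Context: Let $I=[x_0,x_N]$, $J=[y_0,y_M]$ and let $\Delta$ be a net $x_0<x_1<\dots<x_N$, $y_0<y_1<\dots<y_M$, with $N,M$ such that the maps below are contractive (i.e. $N,M\ge 2$). Put $I_i=[x_{i-1},x_i]$ and $J_j=[y_{j-1},y_j]$. For $1\le i\le N$, $u_i:I\to I_i$ is the affine bijection with $u_i(x_0)=x_{i-1}$, $u_i(x_N)=x_i$ if $i$ is odd, and $u_i(x_0)=x_i$, $u_i(x_N)=x_{i-1}$ if $i$ is even. For $1\le j\le M$, $v_j:J\to J_j$ is the affine bijection with $v_j(y_0)=y_{j-1}$, $v_j(y_M)=y_j$ if $j$ is odd, and $v_j(y_0)=y_j$, $v_j(y_M)=y_{j-1}$ if $j$ is even. The scale function $\alpha:I\times J\to\mathbb{R}$ is continuous with $\|\alpha\|_\infty<1$. $L:\mathcal{C}(I\times J,\mathbb{R})\to\mathcal{C}(I\times J,\mathbb{R})$ is a bounded linear operator (uniform norm), $L\neq Id$, with $(Lf)(x_i,y_j)=f(x_i,y_j)$ for all $f$ and all $(i,j)\in\{0,N\}\times\{0,M\}$; $\|Id-L\|$ is the operator norm for the uniform norm. For $f\in\mathcal{C}(I\times J,\mathbb{R})$, $\mathcal{F}^{\alpha}_{\Delta,L}(f)=f^{\alpha}_{\Delta,L}$ is the unique continuous function on $I\times J$ satisfying,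 for all $1\le i\le N$, $1\le j\le M$ and $(x,y)\in I_i\times J_j$, $$f^{\alpha}_{\Delta,L}(x,y)=f(x,y)+\alpha(x,y)f^{\alpha}_{\Delta,L}\big(u_i^{-1}(x),v_j^{-1}(y)\big)-\alpha(x,y)(Lf)\big(u_i^{-1}(x),v_j^{-1}(y)\big).$$ $\mathcal{P}(I\times J)$ is the space of all (real) bivariate polynomials on $I\times J$ and $\mathcal{P}^{\alpha}(I\times J)=\mathcal{F}^{\alpha}_{\Delta,L}(\mathcal{P}(I\times J))$. *)

(* Defs.v *)
From HB Require Import structures.
From mathcomp Require Import all_boot all_order all_algebra.
From mathcomp Require Import all_classical all_reals all_analysis.
From mathcomp Require Import ring.

Set Implicit Arguments.
Unset Strict Implicit.
Unset Printing Implicit Defensive.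

Import Order.TTheory GRing.Theory Num.Theory.
Import numFieldNormedType.Exports.

Local Open Scope classical_set_scope.
Local Open Scope ring_scope.

Definition rect (R : realType) (a b c d : R) : set (R * R) :=
  `[a, b]%classic `*` `[c, d]%classic.

(* C([a, b] x [c, d], R): the elements are continuous functions on the subtype
   of points of the rectangle, so two of them are equal as soon as they agree
   on the rectangle. It is made below into a normed module for the uniform
   norm. *)
Definition crect (R : realType) (a b c d : R) : Type :=
  continuousType (set_type (rect a b c d)) R.

Section crect_normed.
Context {R : realType} (a b c d : R).
Local Notation C := (crect a b c d).
Local Notation X := (set_type (rect a b c d)).

Definition crect_fun (f : C) : X -> R := f.

HB.instance Definition _ := Choice.copy C (continuousType X R).

Definition crect_mk (f : X -> R) (cf : continuous f) : C :=
  (mkcts cf : continuousType X R).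

Lemma crect_mkE (f : X -> R) (cf : continuous f) :
  crect_fun (crect_mk cf) = f.
Proof. by []. Qed.

Lemma crectP (f g : C) : crect_fun f =1 crect_fun g -> f = g.
Proof. by move=> fg; apply/continuousEP. Qed.

Lemma crect_continuous (f : C) : continuous (crect_fun f).
Proof. exact: cts_fun. Qed.

Let add_cts (f g : C) : continuous (fun p => crect_fun f p + crect_fun g p).
Proof. by move=> p; apply: (@continuousD R R^o X); exact: crect_continuous. Qed.

Let opp_cts (f : C) : continuous (fun p => - crect_fun f p).
Proof. by move=> p; apply: (@continuousN R R^o X); exact: crect_continuous. Qed.

Let scale_cts (k : R) (f : C) : continuous (fun p => k * crect_fun f p).
Proof. by move=> p; apply: (@continuousM R X); [exact: cst_continuous|exact: crect_continuous]. Qed.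

Let cst_cts (k : R) : continuous (fun _ : X => k).
Proof. exact: cst_continuous. Qed.

Definition crect_add (f g : C) : C := crect_mk (@add_cts f g).
Definition crect_opp (f : C) : C := crect_mk (@opp_cts f).
Definition crect_scale (k : R) (f : C) : C := crect_mk (@scale_cts k f).
Definition crect_cst (k : R) : C := crect_mk (@cst_cts k).

Let addA : associative crect_add.
Proof. by move=> f g h; apply: crectP => p; exact: addrA. Qed.
Let addC : commutative crect_add.
Proof. by move=> f g; apply: crectP => p; exact: addrC. Qed.
Let add0 : left_id (crect_cst 0) crect_add.
Proof. by move=> f; apply: crectP => p; exact: add0r. Qed.
Let addN : left_inverse (crect_cst 0) crect_opp crect_add.
Proof. by move=> f; apply: crectP => p; exact: addNr. Qed.

HB.instance Definition _ := GRing.isZmodule.Build C addA addC add0 addN.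

Let scaleA (k l : R) (f : C) :
  crect_scale k (crect_scale l f) = crect_scale (k * l) f.
Proof. by apply: crectP => p; exact: mulrA. Qed.
Let scale1 : left_id 1 crect_scale.
Proof. by move=> f; apply: crectP => p; exact: mul1r. Qed.
Let scaleDr : right_distributive crect_scale +%R.
Proof. by move=> k f g; apply: crectP => p; exact: mulrDr. Qed.
Let scaleDl (f : C) : {morph crect_scale^~ f : k l / k + l}.
Proof. by move=> k l; apply: crectP => p; exact: mulrDl. Qed.

HB.instance Definition _ :=
  GRing.Zmodule_isLmodule.Build R C scaleA scale1 scaleDr scaleDl.

Lemma crect0E p : crect_fun (0 : C) p = 0. Proof. by []. Qed.
Lemma crectDE (f g : C) p : crect_fun (f + g) p = crect_fun f p + crect_fun g p.
Proof. by []. Qed.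
Lemma crectNE (f : C) p : crect_fun (- f) p = - crect_fun f p.
Proof. by []. Qed.
Lemma crectZE k (f : C) p : crect_fun (k *: f) p = k * crect_fun f p.
Proof. by []. Qed.

Definition supnorm (f : C) : R := sup (range (fun p => `|crect_fun f p|)).

Lemma crect_bounded (f : C) : has_ubound (range (fun p => `|crect_fun f p|)).
Proof.
have ck : compact (valL_ 0 (crect_fun f) @` rect a b c d).
  apply: continuous_compact; last first.
    by apply: compact_setX; exact: segment_compact.
  exact/subspace_valL_continuousP'/crect_continuous.
have [M [_ /(_ (M + 1))]] := compact_bounded ck.
rewrite ltrDl ltr01 => /(_ isT) fM.
exists (M + 1) => _ [p _ <-]; apply: fM; exists (set_val p).
  by apply/set_mem; exact: valP.
by rewrite -[in RHS](valLK 0 (crect_fun f)).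
Qed.

Lemma le_supnorm (f : C) p : `|crect_fun f p| <= supnorm f.
Proof. by apply: ub_le_sup; [exact: crect_bounded|exists p]. Qed.

Lemma supnorm_ge0 (f : C) : 0 <= supnorm f.
Proof.
have [[_ [p _ _]]|s0] := pselect (range (fun p => `|crect_fun f p|) !=set0).
  exact: le_trans (le_supnorm f p).
by rewrite /supnorm sup_out // => -[].
Qed.

Lemma supnorm_le (f : C) M :
  0 <= M -> (forall p, `|crect_fun f p| <= M) -> supnorm f <= M.
Proof.
move=> M0 fM.
have [s0|s0] := pselect (range (fun p => `|crect_fun f p|) !=set0).
  by apply: ge_sup => // _ [p _ <-].
by rewrite /supnorm sup_out // => -[].
Qed.

Let supnormD (f g : C) : supnorm (f + g) <= supnorm f + supnorm g.
Proof.
apply: supnorm_le => [|p]; first by rewrite addr_ge0 ?supnorm_ge0.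
by rewrite crectDE (le_trans (ler_normD _ _)) // lerD ?le_supnorm.
Qed.

Let supnormZ (k : R) (f : C) : supnorm (k *: f) = `|k| * supnorm f.
Proof.
have le l h : supnorm (l *: h) <= `|l| * supnorm h.
  apply: supnorm_le => [|p]; first by rewrite mulr_ge0 ?supnorm_ge0.
  by rewrite crectZE normrM ler_wpM2l ?le_supnorm.
apply/eqP; rewrite eq_le le /=.
have [->|k0] := eqVneq k 0; first by rewrite normr0 mul0r supnorm_ge0.
have := le k^-1 (k *: f).
by rewrite scalerA mulVf // scale1r normfV ler_pdivlMl ?normr_gt0.
Qed.

Let supnorm0_eq0 (f : C) : supnorm f = 0 -> f = 0.
Proof.
move=> f0; apply: crectP => p; apply/eqP; rewrite -normr_le0 -f0.
exact: le_supnorm.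
Qed.

HB.instance Definition _ :=
  Lmodule_isNormed.Build R C supnormD supnormZ supnorm0_eq0.

Lemma crect_normE (f : C) : `|f| = supnorm f. Proof. by []. Qed.

(* [ceval f x y] is f(x, y) if (x, y) is in the rectangle (and 0 otherwise). *)
Definition ceval (f : C) (x y : R) : R := valL_ 0 (crect_fun f) (x, y).

Lemma cevalE (f : C) (p : X) :
  ceval f (set_val p).1 (set_val p).2 = crect_fun f p.
Proof.
by rewrite /ceval -surjective_pairing -[in RHS](valLK 0 (crect_fun f)).
Qed.

Definition is_bivariate_poly (f : C) : Prop :=
  exists P : {poly {poly R}}, forall x y, rect a b c d (x, y) ->
    ceval f x y = P.[x%:P].[y].

End crect_normed.

(* Meaningful for bounded T; for an unbounded T the convention sup = 0 of the
   library applies. *)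
Definition opnorm (R : realType) (V W : normedModType R) (T : V -> W) : R :=
  sup [set `|T f| | f in [set f : V | `|f| <= 1]].

Section fold_maps.
Context {R : realType}.

(* The affine map sending a to c and b to d (a != b). *)
Definition affine_map (a b c d t : R) : R := c + (t - a) / (b - a) * (d - c).

Lemma affine_map_l a b c d : affine_map a b c d a = c.
Proof. by rewrite /affine_map subrr !mul0r addr0. Qed.

Lemma affine_map_r a b c d : a != b -> affine_map a b c d b = d.
Proof.
by move=> ab; rewrite /affine_map divff ?mul1r ?subrKC // subr_eq0 eq_sym.
Qed.

Lemma affine_mapK a b c d : a != b -> c != d ->
  cancel (affine_map a b c d) (affine_map c d a b).
Proof.
move=> ab cd t; rewrite /affine_map; field.
by rewrite !subr_eq0 ![_ == a]eq_sym ![_ == c]eq_sym ab cd.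
Qed.

(* For a net x 0 < ... < x n and 1 <= i <= n, the affine bijection from
   [x 0, x n] to [x i.-1, x i], increasing for odd i, decreasing for even i. *)
Definition fold_map (n : nat) (x : nat -> R) (i : nat) : R -> R :=
  if odd i then affine_map (x 0%N) (x n) (x i.-1) (x i)
  else affine_map (x 0%N) (x n) (x i) (x i.-1).

Definition fold_map_inv (n : nat) (x : nat -> R) (i : nat) : R -> R :=
  if odd i then affine_map (x i.-1) (x i) (x 0%N) (x n)
  else affine_map (x i) (x i.-1) (x 0%N) (x n).

Definition is_net (n : nat) (x : nat -> R) : Prop :=
  forall i, (i < n)%N -> x i < x i.+1.

Lemma is_net_lt n x : is_net n x ->
  forall i j, (i < j)%N -> (j <= n)%N -> x i < x j.
Proof.
move=> xn i; elim=> // j IH; rewrite ltnS leq_eqVlt => /predU1P[->|ij] jn.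
  exact: xn.
by apply: lt_trans (xn _ jn); apply: IH => //; exact: ltnW.
Qed.

Lemma fold_map_0 n x i :
  fold_map n x i (x 0%N) = if odd i then x i.-1 else x i.
Proof. by rewrite /fold_map; case: odd; rewrite affine_map_l. Qed.

Lemma fold_map_n n x i : is_net n x -> (0 < n)%N ->
  fold_map n x i (x n) = if odd i then x i else x i.-1.
Proof.
move=> xn n0; have x0n : x 0%N < x n by exact: is_net_lt xn _ _ _ _.
by rewrite /fold_map; case: odd; rewrite affine_map_r ?(lt_eqF x0n).
Qed.

Lemma fold_mapK n x i : is_net n x -> (0 < i <= n)%N ->
  cancel (fold_map n x i) (fold_map_inv n x i) /\
  cancel (fold_map_inv n x i) (fold_map n x i).
Proof.
move=> xn /andP[i0 iN].
have x0n : x 0%N < x n by apply: is_net_lt xn _ _ _ _ => //; exact: leq_trans iN.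
have xii : x i.-1 < x i by apply: is_net_lt xn _ _ _ _ => //; rewrite prednK.
rewrite /fold_map /fold_map_inv.
by case: odd; split; apply: affine_mapK;
  rewrite ?(lt_eqF x0n) ?(lt_eqF xii) ?(gt_eqF xii).
Qed.

End fold_maps.

Section fractal_function.
Context {R : realType} (N M : nat) (x y : nat -> R).
Local Notation C := (crect (x 0%N) (x N) (y 0%N) (y M)).
Implicit Types (alpha f g : C) (L : C -> C).

Definition is_fractal_function alpha L f g : Prop :=
  forall i j, (1 <= i <= N)%N -> (1 <= j <= M)%N ->
  forall s t, s \in `[x i.-1, x i] -> t \in `[y j.-1, y j] ->
    ceval g s t = ceval f s t
      + ceval alpha s t * ceval g (fold_map_inv N x i s) (fold_map_inv M y j t)
      - ceval alpha s t
        * ceval (L f) (fold_map_inv N x i s) (fold_map_inv M y j t).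

(* The operator f |-> f^alpha, by definite description: [xget 0] returns the
   solution of the functional equation, which exists and is unique when x and
   y are nets and `|alpha| < 1. *)
Definition fractal_operator alpha L : C -> C :=
  fun f => xget 0 [set g | is_fractal_function alpha L f g].

Definition fractal_polys alpha L : set C :=
  fractal_operator alpha L @` [set f | is_bivariate_poly f].

End fractal_function.

(* Main.v *)
Require Import Defs.
From HB Require Import structures.
From mathcomp Require Import all_boot all_order all_algebra.
From mathcomp Require Import all_classical all_reals all_analysis.
From mathcomp Require Import ring lra.

Set Implicit Arguments.
Unset Strict Implicit.
Unset Printing Implicit Defensive.

Import Order.TTheory GRing.Theory Num.Theory.
Import numFieldNormedType.Exports.

Local Open Scope classical_set_scope.
Local Open Scope ring_scope.

(** Write [F] for the fractal operator, [Phi] for the map of the rectangle to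
    itself that folds every cell affinely onto the whole rectangle, and
    [T g = alpha * (g o Phi)]. The cell maps alternate in orientation, so the
    inverses attached to two adjacent cells agree on the common edge. Hence
    [Phi] is continuous, [T] is a linear operator on the continuous functions
    with [`|T g| <= `|alpha| * `|g|], and the functional equation on the cells
    is the single equation [g = f + T (g - L f)] ([fractal_functionP]).
    As [`|alpha| < 1], the right-hand side is a contraction in [g]; Banach's
    theorem gives existence and uniqueness, and uniqueness makes [F] additive.

    Subtracting [f] from the equation for [F f] gives
    [F f - f = T (F f - f) + T (f - L f)], so [`|F f - f| <= k * `|f|] with
    [k = `|alpha| * opnorm (Id - L) / (1 - `|alpha|)]
    ([fractal_operator_near_id]). The bound assumed on [alpha] says exactly
    that [k < 1]: [F] is at distance less than one from the identity. An
    additive operator of this kind maps dense subgroups onto dense sets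
    ([dense_image_near_id]): approximating [v] by [w] in the subgroup, the
    image [F w] misses [v] by little more than [k * `|v|], and the residual
    [v - F w] can be treated in the same way again, so that the errors decrease
    geometrically.

    It remains to see that the polynomials are dense ([weierstrass_crect]).
    This is Bernstein's proof in two variables. A continuous function on the
    rectangle satisfies [`|f p - f q| <= e + K * dist(p, q)^2]
    ([crect_modulus]); averaging this inequality against the product of two
    binomial laws, whose variances are of order [1/n], shows that the Bernstein
    polynomials of [f] are uniformly within [e + O(1/n)] of [f]. *)

(** * Bernstein averages *)

(** The average of [phi i] when [i] follows the binomial law of parameters [n]
    and [s], that is, the sum of the
    ['C(n, i) * s ^+ i * (1 - s) ^+ (n - i) * phi i]; the recursion conditions on
    one of the [n] trials. With this form the
    moments below are obtained by induction, without binomial identities, and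
    letting [s] range over a ring of polynomials turns the averages into
    polynomials. *)
Fixpoint bernstein (A : comNzRingType) (s : A) (n : nat) (phi : nat -> A) : A :=
  if n is m.+1 then
    (1 - s) * bernstein s m phi + s * bernstein s m (fun i => phi i.+1)
  else phi 0%N.

Section bernstein_theory.
Context {A : comNzRingType}.
Implicit Types (s c : A) (phi psi : nat -> A).

Lemma bernstein_cst s n c : bernstein s n (fun=> c) = c.
Proof. by elim: n => //= n IH; rewrite IH; ring. Qed.

Lemma bernsteinD s n phi psi :
  bernstein s n (fun i => phi i + psi i) =
  bernstein s n phi + bernstein s n psi.
Proof. by elim: n phi psi => //= n IH phi psi; rewrite !IH; ring. Qed.

Lemma bernsteinZ s n c phi :
  bernstein s n (fun i => c * phi i) = c * bernstein s n phi.
Proof. by elim: n phi => //= n IH phi; rewrite !IH; ring. Qed.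

Lemma bernstein_centered s n : bernstein s n (fun i => i%:R - n%:R * s) = 0.
Proof.
elim: n => [|n IH] /=; first by ring.
have -> : (fun i => i%:R - n.+1%:R * s) = fun i => (i%:R - n%:R * s) + (- s).
  by apply/funext => i; rewrite -natr1; ring.
have -> : (fun i => i.+1%:R - n.+1%:R * s) =
    fun i => (i%:R - n%:R * s) + (1 - s).
  by apply/funext => i; rewrite -!natr1; ring.
by rewrite !(bernsteinD _ _ (fun i => i%:R - n%:R * s)) !bernstein_cst IH; ring.
Qed.

(** One more trial shifts the centred variable by [1 - s] with weight [s] and by
    [- s] with weight [1 - s]; the cross terms vanish because the mean is zero,
    so every trial adds [s * (1 - s)]. *)
Lemma bernstein_variance s n :
  bernstein s n (fun i => (i%:R - n%:R * s) ^+ 2) = n%:R * (s * (1 - s)).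
Proof.
elim: n => [|n IH] /=; first by ring.
have step c : bernstein s n (fun i => (i%:R - n%:R * s + c) ^+ 2) =
    n%:R * (s * (1 - s)) + c ^+ 2.
  have -> : (fun i => (i%:R - n%:R * s + c) ^+ 2) =
      fun i => (i%:R - n%:R * s) ^+ 2 +
               (c *+ 2 * (i%:R - n%:R * s) + c ^+ 2).
    by apply/funext => i; ring.
  rewrite !bernsteinD (bernsteinZ _ _ (c *+ 2)) bernstein_centered.
  by rewrite bernstein_cst IH; ring.
have -> : (fun i => (i%:R - n.+1%:R * s) ^+ 2) =
    fun i => (i%:R - n%:R * s - s) ^+ 2.
  by apply/funext => i; rewrite -natr1; ring.
have -> : (fun i => (i.+1%:R - n.+1%:R * s) ^+ 2) =
    fun i => (i%:R - n%:R * s + (1 - s)) ^+ 2.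
  by apply/funext => i; rewrite -!natr1; ring.
by rewrite !step -natr1; ring.
Qed.

Lemma rmorph_bernstein (B : comNzRingType) (h : {rmorphism A -> B}) s n phi :
  h (bernstein s n phi) = bernstein (h s) n (h \o phi).
Proof.
by elim: n phi => //= n IH phi; rewrite rmorphD !rmorphM !IH rmorphB rmorph1.
Qed.

End bernstein_theory.

Section bernstein_estimate.
Context {R : realFieldType}.
Implicit Types (s l e K : R) (phi psi : nat -> R).

Lemma le_bernstein s n phi psi : 0 <= s <= 1 ->
  (forall i, (i <= n)%N -> phi i <= psi i) ->
  bernstein s n phi <= bernstein s n psi.
Proof.
move=> /andP[s0 s1]; elim: n phi psi => [|n IH] phi psi le /=; first exact: le.
rewrite lerD// ler_wpM2l ?subr_ge0// IH// => i ni; first exact/le/leqW.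
exact: le.
Qed.

(** Chebyshev's argument: averaging the hypothesis leaves the variance
    [s * (1 - s) / n] of [i / n], which is at most [1 / n]. *)
Lemma bernstein_dist s n phi l e K : 0 <= s <= 1 -> (0 < n)%N -> 0 <= K ->
  (forall i, (i <= n)%N -> `|phi i - l| <= e + K * (i%:R / n%:R - s) ^+ 2) ->
  `|bernstein s n phi - l| <= e + K / n%:R.
Proof.
move=> s01 n0 K0 le.
have nn0 : n%:R != 0 :> R by rewrite pnatr_eq0 -lt0n.
pose w i := e + K / n%:R ^+ 2 * (i%:R - n%:R * s) ^+ 2.
have ww : bernstein s n w <= e + K / n%:R.
  rewrite /w bernsteinD bernstein_cst bernsteinZ bernstein_variance lerD2l.
  have -> : K / n%:R ^+ 2 * (n%:R * (s * (1 - s))) = K / n%:R * (s * (1 - s)).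
    by field.
  rewrite ler_piMr ?divr_ge0//.
  by case/andP: s01 => s0 s1; nra.
have lew i : (i <= n)%N -> `|phi i - l| <= w i.
  move=> /le /le_trans; apply; rewrite /w lerD2l.
  by rewrite le_eqVlt; apply/orP; left; apply/eqP; field.
have lo : bernstein s n (fun i => l + - 1 * w i) <= bernstein s n phi.
  by apply: le_bernstein => // i /lew; rewrite ler_norml => /andP[]; lra.
have hi : bernstein s n phi <= bernstein s n (fun i => l + 1 * w i).
  by apply: le_bernstein => // i /lew; rewrite ler_norml => /andP[]; lra.
move: lo hi; rewrite !bernsteinD !bernstein_cst !bernsteinZ => lo hi.
by rewrite ler_norml; apply/andP; split; lra.
Qed.

Lemma bernstein2_dist s t n (g : nat -> nat -> R) l e K K' :
  0 <= s <= 1 -> 0 <= t <= 1 -> (0 < n)%N -> 0 <= K -> 0 <= K' ->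
  (forall i j, (i <= n)%N -> (j <= n)%N -> `|g i j - l| <=
     e + K * (i%:R / n%:R - s) ^+ 2 + K' * (j%:R / n%:R - t) ^+ 2) ->
  `|bernstein s n (fun i => bernstein t n (g i)) - l| <= e + (K + K') / n%:R.
Proof.
move=> s01 t01 n0 K0 K'0 le.
have := @bernstein_dist s n (fun i => bernstein t n (g i)) l (e + K' / n%:R) K
  s01 n0 K0.
rewrite mulrDl [in _ -> _]addrA addrAC; apply => i ni.
rewrite addrAC; apply: bernstein_dist => // j nj; exact: le.
Qed.

End bernstein_estimate.

(** * Retraction of the plane onto a rectangle *)

Section retraction.
Context {R : realType}.
Implicit Types a b c d : R.

Definition clamp a b t : R := Num.max a (Num.min t b).

Lemma clamp_itv a b t : a <= b -> a <= clamp a b t <= b.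
Proof. by move=> ab; rewrite /clamp le_max lexx ge_max ab ge_min lexx orbT. Qed.

Lemma clamp_id a b t : a <= t <= b -> clamp a b t = t.
Proof.
by move=> /andP[at_ tb]; rewrite /clamp min_l// max_r.
Qed.

Lemma clamp_l a b t : a <= b -> t <= a -> clamp a b t = a.
Proof. by move=> ab ta; rewrite /clamp max_l// ge_min ta. Qed.

Lemma clamp_r a b t : a <= b -> b <= t -> clamp a b t = b.
Proof. by move=> ab bt; rewrite /clamp min_r// max_r. Qed.

Lemma clamp_continuous a b : continuous (clamp a b).
Proof.
move=> t; apply: (@continuous_max _ R (cst a) (fun t => Num.min t b)).
  exact: cst_continuous.
apply: (@continuous_min _ R id (cst b)); last exact: cst_continuous.
by move=> ?; exact: cvg_id.
Qed.

Variables a b c d : R.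
Hypotheses (ab : a <= b) (cd : c <= d).
Local Notation X := (set_type (rect a b c d)).
Local Notation C := (crect a b c d).

Lemma retr_subproof (p : R * R) :
  (clamp a b p.1, clamp c d p.2) \in rect a b c d.
Proof. by apply/mem_set; split => /=; rewrite in_itv /= clamp_itv. Qed.

(** Composing with this retraction extends a continuous function from the
    rectangle to the plane; continuity can then be treated on [R * R], where
    projections and products are available, and maps into the rectangle can be
    built from maps into the plane. *)
Definition retr (p : R * R) : X :=
  exist (fun q => q \in rect a b c d) _ (retr_subproof p).

Lemma retr_val (p : X) : retr (\val p) = p.
Proof.
apply/val_inj; case: p => -[s t] /= st; have [/=] := set_mem st.
by rewrite !in_itv /= => sab tcd; rewrite !clamp_id.
Qed.

Lemma retr_continuous : continuous retr.
Proof.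
apply: (@continuous_comp_initial X _ _ set_val retr) => p.
apply: (@cvg_pair _ _ _ (nbhs p) (nbhs (clamp a b p.1)) (nbhs (clamp c d p.2))
  _ _ _ (fun q => clamp a b q.1) (fun q => clamp c d q.2)).
  apply: (@continuous_comp _ _ _ fst (clamp a b)); first exact: cvg_fst.
  exact: clamp_continuous.
apply: (@continuous_comp _ _ _ snd (clamp c d)); first exact: cvg_snd.
exact: clamp_continuous.
Qed.

Lemma ceval_retr (f : C) s t :
  rect a b c d (s, t) -> ceval f s t = crect_fun f (retr (s, t)).
Proof.
move=> st; rewrite -cevalE /= !clamp_id //.
  by have [_ /=] := st; rewrite in_itv.
by have [/= + _] := st; rewrite in_itv.
Qed.

End retraction.

(** * Density of the polynomials *)

Section modulus.
Context {R : realType} (a b c d : R).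
Hypotheses (ab : a <= b) (cd : c <= d).
Local Notation X := (set_type (rect a b c d)).
Local Notation C := (crect a b c d).

(** For each pair of points some [K] gives a strict inequality: [K = 0] when the
    points coincide, a large [K] otherwise. By continuity the same [K] works on
    a neighbourhood of the pair, and larger values work as well; compactness of
    the set of pairs then yields one [K] for all. *)
Lemma crect_modulus (f : C) (e : R) : 0 < e ->
  exists2 K : R, 0 <= K & forall p q : X,
    `|crect_fun f p - crect_fun f q| <=
    e + K * (((\val p).1 - (\val q).1) ^+ 2 + ((\val p).2 - (\val q).2) ^+ 2).
Proof.
move=> e0.
pose F (p : R * R) : R := crect_fun f (retr ab cd p).
have cF : continuous F.
  move=> p; apply: (@continuous_comp _ _ _ (retr ab cd)).
    exact: retr_continuous.
  exact: crect_continuous.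
pose D (z : (R * R) * (R * R)) := (z.1.1 - z.2.1) ^+ 2 + (z.1.2 - z.2.2) ^+ 2.
have D_ge0 z : 0 <= D z by rewrite addr_ge0 ?sqr_ge0.
pose h (K : R) z := e + K * D z - `|F z.1 - F z.2|.
have ch K : continuous (h K).
  pose Z := ((R * R) * (R * R))%type.
  have c11 : continuous (fun z : (R * R) * (R * R) => z.1.1).
    by move=> z; apply: continuous_comp; exact: cvg_fst.
  have c12 : continuous (fun z : (R * R) * (R * R) => z.1.2).
    by move=> z; apply: continuous_comp; [exact: cvg_fst|exact: cvg_snd].
  have c21 : continuous (fun z : (R * R) * (R * R) => z.2.1).
    by move=> z; apply: continuous_comp; [exact: cvg_snd|exact: cvg_fst].
  have c22 : continuous (fun z : (R * R) * (R * R) => z.2.2).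
    by move=> z; apply: continuous_comp; exact: cvg_snd.
  rewrite /h /D /= => z; apply: (@continuousB R R^o Z).
    apply: (@continuousD R R^o Z); first exact: cst_continuous.
    apply: (@continuousM R Z); first exact: cst_continuous.
    apply: (@continuousD R R^o Z).
      by apply: (@continuousM R Z); apply: (@continuousB R R^o Z);
        [exact: c11|exact: c21|exact: c11|exact: c21].
    by apply: (@continuousM R Z); apply: (@continuousB R R^o Z);
        [exact: c12|exact: c22|exact: c12|exact: c22].
  apply: (@continuous_comp _ _ _ (fun z => F z.1 - F z.2) Num.norm).
    apply: (@continuousB R R^o Z).
      by apply: continuous_comp; [exact: cvg_fst|exact: cF].
    by apply: continuous_comp; [exact: cvg_snd|exact: cF].
  exact: (@norm_continuous R R^o).
have /compact_near_coveringP : compact (rect a b c d `*` rect a b c d).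
  by apply: compact_setX; apply: compact_setX; exact: segment_compact.
move=> /(_ nat \oo (fun n z => 0 < h n%:R z)) [|N _ /(_ N (leqnn N)) hN].
- move=> z _.
  have [n hn] : exists n : nat, 0 < h n%:R z.
    have := D_ge0 z; rewrite le_eqVlt => /predU1P[Dz|Dz].
      exists 0%N; rewrite /h mul0r addr0.
      suff -> : z.1 = z.2 by rewrite subrr normr0 subr0.
      move: Dz; rewrite /D => /esym/eqP; rewrite paddr_eq0 ?sqr_ge0//.
      rewrite !sqrf_eq0 !subr_eq0 => /andP[/eqP z1 /eqP z2].
      by move: z1 z2; case: (z.1) (z.2) => [? ?] [? ?] /= -> ->.
    exists (Num.bound (`|F z.1 - F z.2| / D z)).
    have /archi_boundP : 0 <= `|F z.1 - F z.2| / D z by rewrite divr_ge0.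
    rewrite ltr_pdivrMr// => lt; rewrite /h; lra.
  exists ([set z | 0 < h n%:R z], [set m | (n <= m)%N]).
    by split; [exact: (cvgr_gt _ (ch n%:R z))|exact: nbhs_infty_ge].
  move=> [z' m] [/= hz' nm]; apply: lt_le_trans hz' _.
  by rewrite /h lerD2r lerD2l ler_wpM2r// ler_nat.
- exists N%:R => // p q.
  have := hN (\val p, \val q); rewrite /h /F !retr_val /D /=.
  rewrite subr_gt0 => /(_ _)/ltW; apply.
  by split; exact: set_valP.
Qed.

End modulus.

Section weierstrass.
Context {R : realType} (a b c d : R).
Local Notation X := (set_type (rect a b c d)).
Local Notation C := (crect a b c d).

Lemma horner2_continuous (P : {poly {poly R}}) :
  continuous (fun p : X => P.[(\val p).1%:P].[(\val p).2]).
Proof.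
have cval : continuous (set_val : X -> R * R) by exact: initial_continuous.
have c1 : continuous (fun p : X => (\val p).1).
  by move=> p; apply: (@continuous_comp X _ _ set_val fst);
    [exact: cval|exact: cvg_fst].
have c2 : continuous (fun p : X => (\val p).2).
  by move=> p; apply: (@continuous_comp X _ _ set_val snd);
    [exact: cval|exact: cvg_snd].
elim/poly_ind: P => [|P q IH].
  rewrite (_ : (fun p : X => _) = fun=> 0); last first.
    by apply/funext => p; rewrite !horner0.
  exact: cst_continuous.
rewrite (_ : (fun p : X => _) =
    fun p => P.[(\val p).1%:P].[(\val p).2] * (\val p).1 + q.[(\val p).2]);
  last by apply/funext => p; rewrite !hornerE.
move=> p; apply: (@continuousD R R^o X).
  by apply: (@continuousM R X); [exact: IH|exact: c1].
apply: (@continuous_comp X _ _ (fun p : X => (\val p).2) (horner q)).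
  exact: c2.
exact: continuous_horner.
Qed.

Definition poly_crect (P : {poly {poly R}}) : C :=
  crect_mk (@horner2_continuous P).

Lemma poly_crect_is_poly (P : {poly {poly R}}) :
  is_bivariate_poly (poly_crect P).
Proof.
exists P => s t st.
have /= := cevalE (poly_crect P) (exist (fun q => q \in _) _ (mem_set st)).
by move=> ->.
Qed.

Hypotheses (ab : a < b) (cd : c < d).

Let s_ (p : X) : R := ((\val p).1 - a) / (b - a).
Let t_ (p : X) : R := ((\val p).2 - c) / (d - c).

Let s_01 p : 0 <= s_ p <= 1.
Proof.
have [/= + _] := set_valP p; rewrite in_itv /= => /andP[ap pb].
rewrite /s_ divr_ge0 ?subr_ge0 ?(ltW ab)//.
by rewrite ler_pdivrMr ?subr_gt0// mul1r lerD2r.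
Qed.

Let t_01 p : 0 <= t_ p <= 1.
Proof.
have [_ /=] := set_valP p; rewrite in_itv /= => /andP[ap pb].
rewrite /t_ divr_ge0 ?subr_ge0 ?(ltW cd)//.
by rewrite ler_pdivrMr ?subr_gt0// mul1r lerD2r.
Qed.

(** The Bernstein polynomial for the values [g i j] at the nodes; the outer
    variable of [{poly {poly R}}] is the first coordinate. *)
Let sample_poly (n : nat) (g : nat -> nat -> R) : {poly {poly R}} :=
  bernstein (((b - a)^-1)%:P%:P * ('X - a%:P%:P)) n
    (fun i => (bernstein ((d - c)^-1 *: ('X - c%:P)) n
      (fun j => (g i j)%:P))%:P).

Let sample_polyE n g (p : X) : crect_fun (poly_crect (sample_poly n g)) p =
  bernstein (s_ p) n (fun i => bernstein (t_ p) n (g i)).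
Proof.
rewrite -[LHS]/(horner_eval (\val p).2 (horner_eval (\val p).1%:P _)).
rewrite /sample_poly !rmorph_bernstein.
congr bernstein; first by rewrite /= /horner_eval !hornerE mulrC.
apply/funext => i /=; rewrite /horner_eval hornerC.
rewrite -/(horner_eval (\val p).2 _) rmorph_bernstein.
congr bernstein; first by rewrite /= /horner_eval !hornerE mulrC.
by apply/funext => j /=; rewrite /horner_eval hornerC.
Qed.

Theorem weierstrass_crect (f : C) (e : R) : 0 < e ->
  exists2 q : C, is_bivariate_poly q & `|f - q| < e.
Proof.
move=> e0; have e4 : 0 < e / 4 by lra.
have [K K0 modf] := crect_modulus (ltW ab) (ltW cd) f e4.
(* The nodes are at distances (b - a)(i / n - s_ p) and (d - c)(j / n - t_ p)
   from p, hence these two weights for the squares of the rescaled distances. *)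
set K1 := K * (b - a) ^+ 2; set K2 := K * (d - c) ^+ 2.
have K10 : 0 <= K1 by rewrite mulr_ge0 ?sqr_ge0.
have K20 : 0 <= K2 by rewrite mulr_ge0 ?sqr_ge0.
pose n := (Num.bound ((K1 + K2) / (e / 4))).+1.
have n0 : 0 < n%:R :> R by rewrite ltr0n.
have nK : (K1 + K2) / n%:R <= e / 4.
  have /archi_boundP : 0 <= (K1 + K2) / (e / 4).
    by rewrite divr_ge0 ?addr_ge0 ?(ltW e4).
  rewrite ltr_pdivrMr// ler_pdivrMr// => /ltW /le_trans; apply.
  by rewrite mulrC ler_wpM2l ?(ltW e4)// ler_nat.
pose node (u v : R) (i : nat) := u + i%:R / n%:R * (v - u).
pose g i j := crect_fun f (retr (ltW ab) (ltW cd) (node a b i, node c d j)).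
exists (poly_crect (sample_poly n g)); first exact: poly_crect_is_poly.
apply: (@le_lt_trans _ _ (e / 4 + e / 4)); last by lra.
rewrite crect_normE; apply: supnorm_le => [|p]; first by lra.
rewrite crectDE crectNE sample_polyE distrC.
apply: le_trans (_ : e / 4 + (K1 + K2) / n%:R <= _); last by rewrite lerD2l.
apply: bernstein2_dist => // i j ni nj.
apply: le_trans (modf _ _) _.
have node_in u v k : u < v -> (k <= n)%N -> clamp u v (node u v k) = node u v k.
  move=> uv kn; rewrite clamp_id// /node.
  have kn0 : 0 <= k%:R / n%:R :> R by rewrite divr_ge0.
  have kn1 : k%:R / n%:R <= 1 :> R by rewrite ler_pdivrMr// mul1r ler_nat.
  by apply/andP; split; nra.
rewrite /= !node_in// -[leRHS]addrA lerD2l mulrDr.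
have ba0 : b - a != 0 by rewrite subr_eq0 gt_eqF.
have dc0 : d - c != 0 by rewrite subr_eq0 gt_eqF.
rewrite le_eqVlt; apply/orP; left; apply/eqP; rewrite /K1 /K2 /node /s_ /t_.
by field; rewrite ba0 dc0 (gt_eqF n0).
Qed.

End weierstrass.

(** * Completeness of the space of continuous functions *)

Section completeness.
Context {R : realType} (a b c d : R).
Local Notation X := (set_type (rect a b c d)).
Local Notation C := (crect a b c d).

(** A Cauchy filter converges in the complete space of all functions with the
    uniform structure; the limit is continuous, being a uniform limit, and the
    supremum norm measures uniform convergence. *)
Lemma crect_cauchy_cvg (F : set_system C) :
  ProperFilter F -> cauchy F -> cvg F.
Proof.
move=> PF /cauchy_ballP cF.
pose ev (f : C) : arrow_uniform_type X R := crect_fun f.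
pose G : set_system (arrow_uniform_type X R) := ev @ F.
have cG : cvg G.
  apply/cauchy_cvgP/cauchy_ballP => e e0.
  have [[A B] /= [FA FB] AB] := cF _ e0.
  exists (ev @` A, ev @` B).
    by split; rewrite /G /nbhs/=; [apply: filterS FA|apply: filterS FB] => f;
      exists f.
  move=> [_ _] [/= [f Af <-] [g Bg <-]] t /=.
  have := AB (f, g) (conj Af Bg); rewrite -ball_normE /= => fg.
  rewrite /ball /=; apply: le_lt_trans fg; exact: (le_supnorm (f - g)).
have GH : {uniform, G --> (lim G : X -> R)}.
  by move=> ?; rewrite /= uniform_nbhsT; exact: cG.
have ch : continuous (lim G : X -> R).
  apply: (@uniform_limit_continuous X R G) => //.
  by apply: (@filterE _ F) => f; exact: crect_continuous.
apply/cvg_ex; exists (crect_mk ch); apply/cvgrPdist_lt => e e0.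
have e2 : 0 < e / 2 by lra.
have hF : F (ev @^-1` ball (lim G) (e / 2)).
  exact: (cG _ (nbhsx_ballx _ _ e2)).
apply: (filterS _ hF) => g /= hg.
apply: (@le_lt_trans _ _ (e / 2)); last by lra.
rewrite crect_normE; apply: supnorm_le => [|p]; first by lra.
exact/ltW/(hg p).
Qed.

End completeness.

HB.instance Definition _ (R : realType) (a b c d : R) :=
  Uniform_isComplete.Build (crect a b c d) (@crect_cauchy_cvg R a b c d).

(** * The folding map of a net *)

Section fold.
Context {R : realType}.
Implicit Types (n : nat) (x : nat -> R) (s : R).

(** The inverses of all the cell maps glued into one function: each summand
    crosses its own cell once, upwards or downwards according to the parity of
    the cell, and is constant outside of it. As a sum of
    clamped affine functions it is visibly continuous. *)
Definition zigzag n x s : R :=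
  x 0%N + (x n - x 0%N) *
    \sum_(k < n) (-1) ^+ k * clamp 0 1 ((s - x k) / (x k.+1 - x k)).

Lemma zigzag_continuous n x : continuous (zigzag n x).
Proof.
pose w k (s : R) := clamp 0 1 ((s - x k) / (x k.+1 - x k)).
have cw k : continuous (w k).
  move=> s; apply: (@continuous_comp R R R (fun s => (s - x k) / _)).
    apply: (@continuousM R R (fun s => s - x k) (cst _)).
      apply: (@continuousB R R^o R id (cst (x k))); first exact: cvg_id.
      exact: cst_continuous.
    exact: cst_continuous.
  exact: clamp_continuous.
pose S m (s : R) := \sum_(k < m) (-1) ^+ k * w k s.
have cS m : continuous (S m).
  rewrite /S; elim: m => [|m IH].
    by under eq_fun do rewrite big_ord0; exact: cst_continuous.
  under eq_fun do rewrite big_ord_recr /=.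
  move=> s; apply: (@continuousD R R^o R _ (fun s => _ * w m s)).
    exact: IH.
  apply: (@continuousM R R (cst _) (w m)); last exact: cw.
  exact: cst_continuous.
move=> s; apply: (@continuousD R R^o R (cst _) (fun s => _ * S n s)).
  exact: cst_continuous.
apply: (@continuousM R R (cst _) (S n)); last exact: cS.
exact: cst_continuous.
Qed.

Lemma is_net_le n x : is_net n x ->
  forall i j, (i <= j)%N -> (j <= n)%N -> x i <= x j.
Proof.
move=> xn i j; rewrite leq_eqVlt => /predU1P[->//|ij] jn.
exact/ltW/(is_net_lt xn).
Qed.

Lemma alternating_sum m : \sum_(k < m) (-1) ^+ k = (odd m)%:R :> R.
Proof.
elim: m => [|m IH]; first by rewrite big_ord0.
by rewrite big_ord_recr /= IH -signr_odd; case: odd => /=; rewrite ?expr1; ring.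
Qed.

(** On the cell from [x m] to [x m.+1] the completed summands alternate in sign
    and add up to the parity of [m], the later ones vanish, and the summand [m]
    is the relative position in the cell, with the sign of that parity. *)
Lemma zigzag_cell n x i s : is_net n x -> (1 <= i <= n)%N ->
  s \in `[x i.-1, x i] -> zigzag n x s = fold_map_inv n x i s.
Proof.
case: i => // m xn /= mn; rewrite in_itv /= => /andP[ms sm].
have xd k : (k < n)%N -> 0 < x k.+1 - x k by move=> ?; rewrite subr_gt0 xn.
have um := xd _ mn; set u := (s - x m) / (x m.+1 - x m).
suff -> : zigzag n x s = x 0%N + (x n - x 0%N) * ((odd m)%:R + (-1) ^+ m * u).
  rewrite /fold_map_inv /= /affine_map -signr_odd /u.
  case: odd => /=; rewrite ?expr1; field.
    by rewrite -opprB oppr_eq0 gt_eqF.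
  by rewrite gt_eqF.
congr (_ + _ * _); rewrite -alternating_sum.
rewrite -!(big_mkord xpredT (fun k => (-1) ^+ k)).
rewrite -(big_mkord xpredT
  (fun k => (-1) ^+ k * clamp 0 1 ((s - x k) / (x k.+1 - x k)))).
rewrite (@big_cat_nat _ _ _ m.+1)//= big_nat_recr//= -addrA; congr (_ + _).
  apply: eq_big_nat => k /= km; rewrite clamp_r// ?mulr1//.
  have kn := ltn_trans km mn.
  rewrite ler_pdivlMr ?xd// mul1r lerD2r (le_trans _ ms)//.
  by rewrite (is_net_le xn)// ltnW.
rewrite clamp_id; last first.
  by rewrite divr_ge0 ?ler_pdivrMr ?mul1r ?lerD2r ?subr_ge0 // ltW ?xn.
rewrite big_nat big1 ?addr0// => k /andP[mk kn].
rewrite clamp_l ?mulr0//.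
rewrite pmulr_lle0 ?invr_gt0 ?xd// subr_le0 (le_trans sm)//.
by rewrite (is_net_le xn)// ltnW.
Qed.

Lemma net_cell n x s : (0 < n)%N -> s \in `[x 0%N, x n] ->
  exists2 i, (1 <= i <= n)%N & s \in `[x i.-1, x i].
Proof.
elim: n => // n IH _; rewrite in_itv /= => /andP[s0 sn].
have [ns|sn'] := leP (x n) s.
  by exists n.+1; rewrite ?leqnn ?in_itv/= ?ns.
have [n0|n0] := posnP n.
  by move: s0 sn'; rewrite n0 => /le_lt_trans /[apply]; rewrite ltxx.
have [||i /andP[i1 iN] si] := IH => //; first by rewrite in_itv /= s0 ltW.
by exists i => //; rewrite i1 leqW.
Qed.

Lemma fold_map_inv_itv n x i s : is_net n x -> (1 <= i <= n)%N ->
  s \in `[x i.-1, x i] -> fold_map_inv n x i s \in `[x 0%N, x n].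
Proof.
case: i => // m xn /= mn; rewrite !in_itv /= => /andP[ms sm].
have um : 0 < x m.+1 - x m by rewrite subr_gt0 xn.
have x0n : x 0%N < x n by apply: (is_net_lt xn) => //; exact: leq_ltn_trans mn.
pose u := (s - x m) / (x m.+1 - x m).
have u0 : 0 <= u by rewrite divr_ge0 ?subr_ge0 // ltW ?xn.
have u1 : u <= 1 by rewrite ler_pdivrMr// mul1r lerD2r.
rewrite /fold_map_inv /= /affine_map; case: odd => /=.
  have -> : (s - x m.+1) / (x m - x m.+1) = 1 - u.
    by rewrite /u; field; rewrite -[x m - _]opprB oppr_eq0 (gt_eqF um).
  by apply/andP; split; nra.
by rewrite -/u; apply/andP; split; nra.
Qed.

End fold.

(** * The fractal operator *)

Section fractal.
Context {R : realType} (N M : nat) (x y : nat -> R).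
Hypotheses (N0 : (0 < N)%N) (M0 : (0 < M)%N).
Hypotheses (hx : is_net N x) (hy : is_net M y).
Local Notation C := (crect (x 0%N) (x N) (y 0%N) (y M)).
Local Notation X := (set_type (rect (x 0%N) (x N) (y 0%N) (y M))).

Let x0N : x 0%N <= x N. Proof. by apply: (is_net_le hx). Qed.
Let y0M : y 0%N <= y M. Proof. by apply: (is_net_le hy). Qed.

Definition fold_pt (p : X) : X :=
  retr x0N y0M (zigzag N x (\val p).1, zigzag M y (\val p).2).

Lemma fold_pt_continuous : continuous fold_pt.
Proof.
have cval : continuous (set_val : X -> R * R) by exact: initial_continuous.
move=> p; apply: (@continuous_comp X _ _
  (fun p : X => (zigzag N x (\val p).1, zigzag M y (\val p).2))); last first.
  exact: retr_continuous.
apply: (@cvg_pair _ _ _ (nbhs p) (nbhs (zigzag N x (\val p).1))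
  (nbhs (zigzag M y (\val p).2)) _ _ _
  (fun q : X => zigzag N x (\val q).1) (fun q : X => zigzag M y (\val q).2)).
  apply: (@continuous_comp X _ _ (fun q : X => (\val q).1) (zigzag N x)).
    by apply: (@continuous_comp X _ _ set_val fst);
      [exact: cval|exact: cvg_fst].
  exact: zigzag_continuous.
apply: (@continuous_comp X _ _ (fun q : X => (\val q).2) (zigzag M y)).
  by apply: (@continuous_comp X _ _ set_val snd); [exact: cval|exact: cvg_snd].
exact: zigzag_continuous.
Qed.

Variable alpha : C.

Lemma weighted_fold_subproof (g : C) :
  continuous (fun p => crect_fun alpha p * crect_fun g (fold_pt p)).
Proof.
move=> p; apply: (@continuousM R X); first exact: crect_continuous.
apply: (@continuous_comp X X R fold_pt); first exact: fold_pt_continuous.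
exact: crect_continuous.
Qed.

Definition weighted_fold (g : C) : C := crect_mk (@weighted_fold_subproof g).

Lemma weighted_foldB (g h : C) :
  weighted_fold (g - h) = weighted_fold g - weighted_fold h.
Proof. by apply: crectP => p; exact: mulrBr. Qed.

Lemma weighted_foldD (g h : C) :
  weighted_fold (g + h) = weighted_fold g + weighted_fold h.
Proof. by apply: crectP => p; exact: mulrDr. Qed.

Lemma norm_weighted_fold (g : C) : `|weighted_fold g| <= `|alpha| * `|g|.
Proof.
rewrite !crect_normE; apply: supnorm_le => [|p].
  by rewrite mulr_ge0 ?supnorm_ge0.
by rewrite crect_mkE normrM ler_pM ?le_supnorm.
Qed.

Variable L : C -> C.

(** The cells cover the rectangle, and on each of them [fold_pt] is the pair of
    inverse cell maps, so the family of equations over the cells is one equation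
    in the space of continuous functions. *)
Lemma fractal_functionP (f g : C) :
  is_fractal_function alpha L f g <-> g = f + weighted_fold (g - L f).
Proof.
have cell (p : X) i j : (1 <= i <= N)%N -> (1 <= j <= M)%N ->
    (\val p).1 \in `[x i.-1, x i] -> (\val p).2 \in `[y j.-1, y j] ->
    forall h : C, ceval h (fold_map_inv N x i (\val p).1)
      (fold_map_inv M y j (\val p).2) = crect_fun h (fold_pt p).
  move=> iN jM si tj h.
  rewrite (ceval_retr x0N y0M); last by split => /=; exact: fold_map_inv_itv.
  by rewrite /fold_pt (zigzag_cell hx iN)// (zigzag_cell hy jM).
split => [fg|fg i j iN jM s t si tj].
  apply: crectP => p; have [/= px py] := set_valP p.
  have [i iN si] := net_cell N0 px; have [j jM tj] := net_cell M0 py.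
  have := fg i j iN jM _ _ si tj.
  rewrite !(cell p i j)// !cevalE => ->.
  rewrite -[RHS]/(crect_fun f p + crect_fun alpha p *
    (crect_fun g (fold_pt p) - crect_fun (L f) (fold_pt p))).
  by rewrite mulrBr addrA.
have st : rect (x 0%N) (x N) (y 0%N) (y M) (s, t).
  move: si tj; rewrite !in_itv /= => /andP[si1 si2] /andP[tj1 tj2].
  case/andP: iN => _ iN; case/andP: jM => _ jM.
  split => /=; rewrite in_itv /=; apply/andP; split.
  - apply: le_trans si1; apply: (is_net_le hx) => //.
    exact: leq_trans (leq_pred _) _.
  - by apply: le_trans si2 _; apply: (is_net_le hx).
  - apply: le_trans tj1; apply: (is_net_le hy) => //.
    exact: leq_trans (leq_pred _) _.
  - by apply: le_trans tj2 _; apply: (is_net_le hy).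
pose p : X := exist (fun q => q \in _) _ (mem_set st).
have atp h : ceval h s t = crect_fun h p := cevalE h p.
have atPhi h : ceval h (fold_map_inv N x i s) (fold_map_inv M y j t) =
  crect_fun h (fold_pt p) := cell p i j iN jM si tj h.
rewrite !atp !atPhi [in LHS]fg.
rewrite -[LHS]/(crect_fun f p + crect_fun alpha p *
  (crect_fun g (fold_pt p) - crect_fun (L f) (fold_pt p))).
by rewrite mulrBr addrA.
Qed.

Hypothesis alpha_lt1 : `|alpha| < 1.

Let step (f g : C) : C := f + weighted_fold (g - L f).

Let step_lipschitz f g h : `|step f g - step f h| <= `|alpha| * `|g - h|.
Proof.
rewrite /step opprD addrACA subrr add0r -weighted_foldB opprB addrA subrK.
exact: norm_weighted_fold.
Qed.

Lemma fractal_function_exists f : exists g, is_fractal_function alpha L f g.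
Proof.
have ctr : is_contraction (totalfun (step f) : {fun [set: C] >-> [set: C]}).
  exists (NngNum (normr_ge0 alpha)); split => //= -[g h] _ /=.
  exact: step_lipschitz.
have [g _ gE] := banach_fixed_point ctr closedT (ex_intro _ 0 I).
by exists g; apply/fractal_functionP.
Qed.

Lemma fractal_function_unique f g h : is_fractal_function alpha L f g ->
  is_fractal_function alpha L f h -> g = h.
Proof.
move=> /fractal_functionP gE /fractal_functionP hE.
apply/eqP; rewrite -subr_eq0 -normr_eq0; apply/eqP.
have := step_lipschitz f g h; rewrite /step -gE -hE.
have := normr_ge0 (g - h); move: alpha_lt1; nra.
Qed.

Lemma fractal_operatorP f :
  is_fractal_function alpha L f (fractal_operator alpha L f).
Proof. exact: xgetPex (fractal_function_exists f). Qed.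

(** The sum of the solutions for [f] and [g] solves the equation for [f + g];
    uniqueness identifies it with the chosen solution. *)
Lemma fractal_operatorD : (forall f g, L (f + g) = L f + L g) ->
  forall f g, fractal_operator alpha L (f + g) =
    fractal_operator alpha L f + fractal_operator alpha L g.
Proof.
move=> LD f g.
apply: (@fractal_function_unique (f + g)); first exact: fractal_operatorP.
have /fractal_functionP Ff := fractal_operatorP f.
have /fractal_functionP Fg := fractal_operatorP g.
apply/fractal_functionP; rewrite {1}Ff {1}Fg.
by rewrite addrACA -weighted_foldD LD opprD [in RHS]addrACA.
Qed.

(** The difference [g - f] solves
    [g - f = weighted_fold (g - f) + weighted_fold (f - L f)], and the first
    term has norm at most [`|alpha| * `|g - f|]. *)
Lemma fractal_operator_near_id f :
  (1 - `|alpha|) * `|fractal_operator alpha L f - f| <=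
  `|alpha| * `|f - L f|.
Proof.
have /fractal_functionP := fractal_operatorP f.
set g := fractal_operator _ _ _ => gE.
have gfE : g - f = weighted_fold (g - f) + weighted_fold (f - L f).
  by rewrite -weighted_foldD addrA subrK {1}gE addrAC subrr add0r.
have := ler_normD (weighted_fold (g - f)) (weighted_fold (f - L f)).
rewrite -gfE.
have := norm_weighted_fold (g - f); have := norm_weighted_fold (f - L f); lra.
Qed.

End fractal.

(** * Images under operators close to the identity *)

Section dense_image.
Context {R : realType} {V : normedModType R}.

Lemma dense_approx (S : set V) :
  (forall v (e : R), 0 < e -> exists2 w, S w & `|v - w| < e) -> dense S.
Proof.
move=> H O [v Ov] oO.
have [e /= e0 eO] : nbhs_ball v O by apply/nbhs_ballP; exact: open_nbhs_nbhs.
have [w Sw vw] := H v e e0.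
by exists w; split => //; apply: eO; rewrite -ball_normE.
Qed.

(** Approximating [u] by [w] in [P] leaves the residual
    [u - F w = (u - w) + (w - F w)], shorter than [u] by a factor [r < 1]; by
    additivity the corrections made at the successive steps can be collected
    into one element of [P]. *)
Lemma dense_image_near_id (F : V -> V) (P : set V) (k : R) :
  0 <= k < 1 -> (forall v w, F (v + w) = F v + F w) ->
  (forall v, `|F v - v| <= k * `|v|) ->
  P 0 -> (forall v w, P v -> P w -> P (v + w)) ->
  (forall v (e : R), 0 < e -> exists2 w, P w & `|v - w| < e) ->
  dense (F @` P).
Proof.
move=> /andP[k0 k1] FD Fk P0 PD Papp; apply: dense_approx => v e e0.
have F0 : F 0 = 0.
  by apply/eqP; rewrite -subr_eq0 -normr_le0 (le_trans (Fk 0))// normr0 mulr0.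
(* With precision (1 - k) / 4 the residual is at most
   (1 - k) / 4 + k * (1 + (1 - k) / 4) <= (1 + k) / 2 times the length of u. *)
pose r := (1 + k) / 2.
have r01 : 0 <= r < 1 by rewrite /r; apply/andP; split; lra.
have step u : exists2 w, P w & `|u - F w| <= r * `|u|.
  have [->|u0] := eqVneq u 0.
    by exists 0; rewrite // F0 subrr normr0 mulr0.
  have un : 0 < `|u| by rewrite normr_gt0.
  have [|w Pw uw] := Papp u ((1 - k) / 4 * `|u|).
    by apply: mulr_gt0 => //; lra.
  exists w => //.
  have wn : `|w| <= `|u| + `|u - w|.
    by rewrite -{1}[w](subKr u) (le_trans (ler_normB _ _)).
  have : `|u - F w| <= `|u - w| + `|F w - w|.
    by rewrite [`|F w - w|]distrC ler_distD.
  have : k * `|w| <= k * `|u| + `|u - w|.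
    by rewrite (le_trans (ler_wpM2l k0 wn))// mulrDr lerD2l ler_piMl// ltW.
  have := Fk w; rewrite /r; lra.
have iter_ n : exists2 w, P w & `|v - F w| <= r ^+ n * `|v|.
  elim: n => [|n [w Pw vw]]; first by exists 0; rewrite // F0 subr0 expr0 mul1r.
  have [w' Pw' vw'] := step (v - F w).
  exists (w + w'); first exact: PD.
  rewrite FD opprD addrA (le_trans vw')// exprS -mulrA ler_wpM2l//.
  by case/andP: r01.
have cr : (fun n => r ^+ n * `|v|) @ \oo --> (0 : R).
  rewrite -(mul0r `|v|); apply: cvgMr_tmp; apply: cvg_expr.
  by case/andP: r01 => r0 r1; rewrite ger0_norm.
have [n _ /(_ n (leqnn n)) /= lt] := cvgr_lt _ cr e e0.
have [w Pw vw] := iter_ n.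
by exists (F w); [exists w|exact: le_lt_trans lt].
Qed.

End dense_image.

(** * The operator norm of a bounded homogeneous map *)

Section opnorm.
Context {R : realType} {V W : normedModType R}.
Variables (T : V -> W) (K : R).
Hypotheses (TZ : forall k v, T (k *: v) = k *: T v)
  (TK : forall v, `|T v| <= K * `|v|).

Let T0 : T 0 = 0. Proof. by rewrite -[X in T X](scale0r 0) TZ scale0r. Qed.

Let opnorm_ub v : `|v| <= 1 -> `|T v| <= opnorm T.
Proof.
move=> v1; apply: ub_le_sup; last by exists v.
exists `|K| => _ [u /= u1 <-]; rewrite (le_trans (TK u))//.
by rewrite (le_trans (ler_norm _))// normrM normr_id ler_piMr.
Qed.

Lemma opnorm_ge0 : 0 <= opnorm T.
Proof. by rewrite (le_trans (normr_ge0 (T 0)))// opnorm_ub// normr0. Qed.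

Lemma le_opnorm v : `|T v| <= opnorm T * `|v|.
Proof.
have [->|v0] := eqVneq v 0; first by rewrite T0 !normr0 mulr0.
have vn : 0 < `|v| by rewrite normr_gt0.
rewrite -ler_pdivrMr// mulrC -[`|v|^-1]ger0_norm ?invr_ge0// -normrZ -TZ.
by apply: opnorm_ub; rewrite normrZ normfV normr_id mulVf ?gt_eqF.
Qed.

End opnorm.

(** * Density of the fractal polynomials *)

Theorem theorem5p13 (R : realType) (N M : nat) (x y : nat -> R)
  (hN : (2 <= N)%N) (hM : (2 <= M)%N)
  (hx : is_net N x) (hy : is_net M y)
  (alpha : crect (x 0%N) (x N) (y 0%N) (y M))
  (alpha_lt1 : `|alpha| < 1)
  (L : {linear crect (x 0%N) (x N) (y 0%N) (y M) ->
               crect (x 0%N) (x N) (y 0%N) (y M)})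
  (L_bounded : exists K : R, forall f, `|L f| <= K * `|f|)
  (L_neq_id : (L : _ -> _) <> idfun)
  (L_corners : forall f i j, i \in [:: 0%N; N] -> j \in [:: 0%N; M] ->
     ceval (L f) (x i) (y j) = ceval f (x i) (y j))
  (alpha_lt : `|alpha| < (1 + opnorm (fun f => f - L f))^-1) :
  dense (fractal_polys alpha L).
Proof.
have N0 : (0 < N)%N by exact: ltnW.
have M0 : (0 < M)%N by exact: ltnW.
have x0N : x 0%N <= x N by exact: is_net_le hx _ _ _ _.
have y0M : y 0%N <= y M by exact: is_net_le hy _ _ _ _.
have [K LK] := L_bounded.
have DZ k f : k *: f - L (k *: f) = k *: (f - L f).
  by rewrite linearZ scalerBr.
have DK f : `|f - L f| <= (1 + K) * `|f|.
  by rewrite (le_trans (ler_normB _ _))// mulrDl mul1r lerD2l.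
set c := opnorm _ in alpha_lt.
have c0 : 0 <= c := opnorm_ge0 DK.
have Dc f : `|f - L f| <= c * `|f| := le_opnorm DZ DK f.
have a1 : 0 < 1 - `|alpha| by rewrite subr_gt0.
pose k := `|alpha| * c / (1 - `|alpha|).
apply: (@dense_image_near_id _ _ _ _ k).
- rewrite /k divr_ge0 ?mulr_ge0 ?(ltW a1)//= ltr_pdivrMr// mul1r.
  have : `|alpha| * (1 + c) < 1.
    by rewrite -ltr_pdivlMr ?div1r// ltr_pwDl.
  by rewrite mulrDr; lra.
- apply: fractal_operatorD => // f g; exact: linearD.
- move=> f; rewrite /k mulrAC ler_pdivlMr// mulrC.
  rewrite (le_trans (fractal_operator_near_id N0 M0 hx hy L alpha_lt1 _))//.
  by rewrite -mulrA ler_wpM2l.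
- exists 0 => s t st; rewrite !horner0.
  by rewrite (ceval_retr x0N y0M).
- move=> f g [P fP] [Q gQ]; exists (P + Q) => s t st.
  by rewrite !hornerD -fP// -gQ// !(ceval_retr x0N y0M).
- move=> f e; apply: weierstrass_crect; first exact: is_net_lt hx _ _ _ _.
  exact: is_net_lt hy _ _ _ _.
Qed.
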